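(* For every $L>0$ there exists a constant $C=C(L)>0$, depending only on $L$, such that the following holds. Let $n\ge 2$, and let $A$ be an $m\times n$ random matrix whose rows $A_i$ are independent, isotropic and sub-gaussian random vectors in $\mathbb{R}^n$ with $\max_i\|A_i\|_{\psi_2}\le L$. Let $x\in\mathbb{R}^n$ be a fixed vector with at most $s$ non-zero coordinates, and let $y=Ax$. Then any solution $\hat x$ (a random vector, depending on $A$) of the optimization program $$\min\|x'\|_1\quad\text{subject to}\quad y=Ax'$$ satisfies $$\mathbb{E}\|\hat x-x\|_2\le C\sqrt{\frac{s\log n}{m}}\;\|x\|_2.$$
   Context: The minimum is over $x'\in\mathbb{R}^n$; $\|x\|_1=\sum_{i}|x_i|$ and $\|\cdot\|_2$ is the Euclidean norm. A random vector $X$ in $\mathbb{R}^n$ is isotropic if $\mathbb{E}XX^{\mathsf T}=I_n$. For a real random variable $Z$, $\|Z\|_{\psi_2}:=\inf\{t>0:\ \mathbb{E}\exp(Z^2/t^2)\le 2\}$, and $Z$ is sub-gaussian if this is finite. A random vector $X$ in $\mathbb{R}^n$ is sub-gaussian if $\langle X,x\rangle$ is sub-gaussian for every $x\in\mathbb{R}^n$, and $\|X\|_{\psi_2}:=\sup_{x\in S^{n-1}}\|\langle X,x\rangle\|_{\psi_2}$, where $S^{n-1}$ is the unit Euclidean sphere. *)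

(* Defs.v *)
From HB Require Import structures.
From mathcomp Require Import all_boot all_order all_algebra.
From mathcomp Require Import all_classical all_reals all_analysis.

Set Implicit Arguments.
Unset Strict Implicit.
Unset Printing Implicit Defensive.

Import Order.TTheory GRing.Theory Num.Theory.

Local Open Scope classical_set_scope.
Local Open Scope ring_scope.

(* The canonical norm of a matrix type, `|x|, is the sup norm, so the l1 and
   Euclidean norms are defined here. *)
Definition l1norm (R : realType) (n : nat) (x : 'cV[R]_n) : R :=
  \sum_(i < n) `|x i 0|.

Definition dotprod (R : realType) (n : nat) (x y : 'cV[R]_n) : R :=
  \sum_(i < n) x i 0 * y i 0.

Definition l2norm (R : realType) (n : nat) (x : 'cV[R]_n) : R :=
  Num.sqrt (\sum_(i < n) x i 0 ^+ 2).

Definition sparse (R : realType) (n : nat) (s : nat) (x : 'cV[R]_n) : Prop :=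
  (#|[set i : 'I_n | x i 0%R != 0%R]%SET| <= s)%N.

Definition l1_min_solution (R : realType) (m n : nat)
    (A : 'M[R]_(m, n)) (y : 'cV[R]_m) (z : 'cV[R]_n) : Prop :=
  y = A *m z /\ forall x' : 'cV[R]_n, y = A *m x' -> l1norm z <= l1norm x'.

(* The Borel sigma-algebra of R^n, as the product sigma-algebra: it is generated
   by the coordinate maps (this is how the library equips n.-tuple R). *)
Definition borel_cV (R : realType) (n : nat) : set (set 'cV[R]_n) :=
  g_sigma_preimage (fun (i : 'I_n) (v : 'cV[R]_n) => v i 0 : measurableTypeR R).

Definition random_vector (R : realType) (d : measure_display)
    (T : measurableType d) (n : nat) (X : T -> 'cV[R]_n) : Prop :=
  forall B : set 'cV[R]_n, borel_cV B -> measurable (X @^-1` B).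

Definition independent_vectors (R : realType) (d : measure_display)
    (T : measurableType d) (P : probability T R) (m n : nat)
    (X : 'I_m -> T -> 'cV[R]_n) : Prop :=
  forall (J : {set 'I_m}) (B : 'I_m -> set 'cV[R]_n),
    (forall i, i \in J -> borel_cV (B i)) ->
    P (\bigcap_(i in [set` J]) (X i @^-1` B i)) =
    (\prod_(i in J) P (X i @^-1` B i))%E.

(* E X X^T = I_n, entry by entry. For measurable X, an extended-real expectation
   with a finite value forces the integrability of its integrand. *)
Definition isotropic (R : realType) (d : measure_display)
    (T : measurableType d) (P : probability T R) (n : nat)
    (X : T -> 'cV[R]_n) : Prop :=
  forall j k : 'I_n,
    'E_P[fun w => (X w *m (X w)^T) j k]%E = ((1%:M : 'M[R]_n) j k)%:E.

(* The infimum is taken in \bar R: it is +oo when no t is admissible. *)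
Definition psi2_norm (R : realType) (d : measure_display)
    (T : measurableType d) (P : probability T R) (Z : T -> R) : \bar R :=
  ereal_inf [set t%:E | t in [set t : R |
    0 < t /\ ('E_P[fun w => expR (Z w ^+ 2 / t ^+ 2)] <= 2%:E)%E]].

Definition subgaussian (R : realType) (d : measure_display)
    (T : measurableType d) (P : probability T R) (Z : T -> R) : Prop :=
  (psi2_norm P Z < +oo)%E.

Definition subgaussian_vector (R : realType) (d : measure_display)
    (T : measurableType d) (P : probability T R) (n : nat)
    (X : T -> 'cV[R]_n) : Prop :=
  forall x : 'cV[R]_n, subgaussian P (fun w => dotprod (X w) x).

Definition psi2_norm_vector (R : realType) (d : measure_display)
    (T : measurableType d) (P : probability T R) (n : nat)
    (X : T -> 'cV[R]_n) : \bar R :=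
  ereal_sup [set psi2_norm P (fun w => dotprod (X w) u) |
             u in [set u : 'cV[R]_n | l2norm u = 1]].

(* The i-th row of a random matrix, as a random vector; vectors are columns. *)
Definition random_row (R : realType) (d : measure_display)
    (T : measurableType d) (m n : nat) (A : T -> 'M[R]_(m, n)) (i : 'I_m) :
    T -> 'cV[R]_n :=
  fun w => (row i (A w))^T.

(* Main.v *)
Require Import Defs.
From mathcomp Require Import all_boot all_order all_algebra.
From mathcomp Require Import all_classical all_reals all_analysis.
From mathcomp Require Import measurable_realfun ring lra.

(* The error h = xhat - x lies in ker A and |h|_1 <= 2 |x|_1 <= 2 sqrt(s) |x|_2,
   so it suffices to bound |h|_2 by sqrt(log n / m) |h|_1 on ker A.  Let Q be the
   quadratic form |Au|_2^2 - (m/4) |u|_2^2.  Maurey's empirical method replaces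
   k h by a sum w of k signed basis vectors (for |h|_1 = 1) with
   Q(w) <= k^2 Q(h) + k (max_i Q(e_i) - Q(h)).  If Q(w) >= 0 for all such w and
   |A e_i|_2^2 = O(m), then |h|_2^2 = O(1/k), since Q(h) = -(m/4) |h|_2^2.  There
   are only (2n)^k vectors w, so a union bound over the exponentially small lower
   tails of |Aw|_2^2, without any net, allows k of order m / log n. *)

Set Implicit Arguments.
Unset Strict Implicit.
Unset Printing Implicit Defensive.

Import Order.TTheory GRing.Theory Num.Theory.
Import numFieldNormedType.Exports.

Local Open Scope classical_set_scope.
Local Open Scope ring_scope.

(** * Elementary facts on the l1 and Euclidean norms *)

Section norms.
Context {R : realType} {n : nat}.
Implicit Types x y z : 'cV[R]_n.

Lemma l1norm_ge0 x : 0 <= l1norm x.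
Proof. exact: sumr_ge0. Qed.

Lemma l1norm_eq0 x : l1norm x = 0 -> x = 0.
Proof.
move=> /eqP; rewrite /l1norm psumr_eq0// => /allP x0; apply/colP => i.
by apply/eqP; rewrite mxE -normr_eq0; exact: x0 (mem_index_enum i).
Qed.

Lemma l1normZ (a : R) x : l1norm (a *: x) = `|a| * l1norm x.
Proof.
by rewrite /l1norm mulr_sumr; apply: eq_bigr => i _; rewrite mxE normrM.
Qed.

Lemma ler_l1normB x y : l1norm (x - y) <= l1norm x + l1norm y.
Proof.
rewrite /l1norm -big_split /=; apply: ler_sum => i _.
by rewrite !mxE ler_normB.
Qed.

Lemma l2norm_ge0 x : 0 <= l2norm x.
Proof. exact: sqrtr_ge0. Qed.

Lemma sqr_l2norm x : l2norm x ^+ 2 = \sum_i x i 0 ^+ 2.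
Proof. by rewrite sqr_sqrtr// sumr_ge0// => i _; exact: sqr_ge0. Qed.

Lemma l2normZ (a : R) x : l2norm (a *: x) = `|a| * l2norm x.
Proof.
rewrite /l2norm -sqrtr_sqr -sqrtrM ?sqr_ge0// mulr_sumr.
by congr Num.sqrt; apply: eq_bigr => i _; rewrite mxE exprMn.
Qed.

Lemma l2norm_eq0 x : l2norm x = 0 -> x = 0.
Proof.
move=> x0; have : \sum_i x i 0 ^+ 2 = 0 by rewrite -sqr_l2norm x0 expr0n.
move=> /eqP; rewrite psumr_eq0 => [/allP x2|i _]; last exact: sqr_ge0.
apply/colP => i; apply/eqP; rewrite mxE -sqrf_eq0.
exact: x2 (mem_index_enum i).
Qed.

Lemma l2norm_le_l1norm x : l2norm x <= l1norm x.
Proof.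
rewrite -(ger0_norm (l1norm_ge0 x)) -sqrtr_sqr ler_wsqrtr//.
rewrite expr2 {1}/l1norm mulr_suml ler_sum// => i _.
rewrite -normr_id -[x i 0 ^+ 2]ger0_norm ?sqr_ge0// normrX expr2 normr_id.
by rewrite ler_wpM2l// /l1norm (bigD1 i)//= lerDl sumr_ge0.
Qed.

Lemma l1norm_sparse s x : sparse s x -> l1norm x <= Num.sqrt s%:R * l2norm x.
Proof.
move=> sx; rewrite -(ger0_norm (l1norm_ge0 x)) -sqrtr_sqr -sqrtrM ?ler0n//.
rewrite ler_wsqrtr//; set S := [set i | x i 0 != 0]%SET in sx *.
(* Cauchy-Schwarz, from [0 <= sum_(i in S) (N |x_i| - l1)^2] with [N = #|S|] *)
have Sl1 : \sum_(i in S) `|x i 0| = l1norm x.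
  rewrite /l1norm [RHS](bigID (mem S))/= [X in _ + X]big1 ?addr0// => i.
  by rewrite inE negbK => /eqP ->; rewrite normr0.
have Sl2 : \sum_(i in S) x i 0 ^+ 2 = \sum_i x i 0 ^+ 2.
  rewrite [RHS](bigID (mem S))/= [X in _ + X]big1 ?addr0// => i.
  by rewrite inE negbK => /eqP ->; rewrite expr0n.
have q0 : 0 <= \sum_i x i 0 ^+ 2 by rewrite -sqr_l2norm sqr_ge0.
(* The final cancellation divides by [#|S|], so an empty support is settled first. *)
have [N0|N0] := posnP #|S|.
  rewrite -Sl1 big1 ?expr0n ?mulr_ge0// => i iS.
  by move: N0 => /eqP; rewrite cards_eq0 => /eqP S0; rewrite S0 inE in iS.
have : 0 <= \sum_(i in S) (#|S|%:R * `|x i 0| - l1norm x) ^+ 2.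
  by apply: sumr_ge0 => i _; exact: sqr_ge0.
have -> : \sum_(i in S) (#|S|%:R * `|x i 0| - l1norm x) ^+ 2 =
    #|S|%:R * (#|S|%:R * (\sum_i x i 0 ^+ 2) - l1norm x ^+ 2).
  have sq i : (#|S|%:R * `|x i 0| - l1norm x) ^+ 2 = #|S|%:R ^+ 2 * x i 0 ^+ 2 +
      (- (2 * #|S|%:R * l1norm x)) * `|x i 0| + l1norm x ^+ 2.
    by rewrite -[x i 0 ^+ 2]real_normK ?num_real//; ring.
  rewrite (eq_bigr _ (fun i _ => sq i)) !big_split /= -!mulr_sumr Sl1 Sl2.
  by rewrite sumr_const -mulr_natl; ring.
rewrite pmulr_rge0 ?ltr0n// subr_ge0 => /le_trans; apply.
by rewrite ler_wpM2r// ler_nat.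
Qed.

End norms.

(** * Maurey's empirical method for a quadratic form *)

Section maurey.
Context {R : realType} {n : nat}.
Implicit Types (G : 'M[R]_n) (u v h : 'cV[R]_n) (a : 'I_n * bool).

Definition bform G u v : R := (u^T *m G *m v) 0 0.

Lemma bformDl G u u' v : bform G (u + u') v = bform G u v + bform G u' v.
Proof. by rewrite /bform linearD /= !mulmxDl mxE. Qed.

Lemma bformDr G u v v' : bform G u (v + v') = bform G u v + bform G u v'.
Proof. by rewrite /bform !mulmxDr mxE. Qed.

Lemma bformZl G c u v : bform G (c *: u) v = c * bform G u v.
Proof. by rewrite /bform linearZ /= -!scalemxAl mxE. Qed.

Lemma bformZr G c u v : bform G u (c *: v) = c * bform G u v.
Proof. by rewrite /bform -!scalemxAr mxE. Qed.

Lemma bform0l G v : bform G 0 v = 0.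
Proof. by rewrite /bform linear0 !mul0mx mxE. Qed.

Lemma bform0r G u : bform G u 0 = 0.
Proof. by rewrite /bform mulmx0 mxE. Qed.

Lemma bform_suml G (I : finType) (F : I -> 'cV[R]_n) v :
  bform G (\sum_i F i) v = \sum_i bform G (F i) v.
Proof.
by apply: (big_morph (bform G ^~ v)) => [x y|]; [exact: bformDl|exact: bform0l].
Qed.

Lemma bform_sumr G (I : finType) (F : I -> 'cV[R]_n) u :
  bform G u (\sum_i F i) = \sum_i bform G u (F i).
Proof.
by apply: (big_morph (bform G u)) => [x y|]; [exact: bformDr|exact: bform0r].
Qed.

(** The boolean [true] encodes a minus sign, so that the finite type ['I_n * bool] indexes the [2n]
    vertices of the l1 unit ball. *)
Definition sgn_delta a : 'cV[R]_n := (-1) ^+ a.2 *: delta_mx a.1 0.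

Lemma bform_sgn_delta G a : bform G (sgn_delta a) (sgn_delta a) = G a.1 a.1.
Proof.
rewrite bformZl bformZr mulrA -expr2 sqrr_sign mul1r /bform.
by rewrite trmx_delta -rowE -colE !mxE.
Qed.

Lemma sum_sgn_delta h :
  \sum_i `|h i 0| *: sgn_delta (i, h i 0 < 0) = h.
Proof.
rewrite [RHS]matrix_sum_delta; apply: eq_bigr => i _.
rewrite big_ord1 /sgn_delta /= scalerA; congr (_ *: _).
by rewrite normrEsign -mulrA mulrC -mulrA -expr2 sqrr_sign mulr1.
Qed.

(** The minimum of [f] is at most its mean under [p]. This lets a deterministic choice stand in for
    a random draw. *)
Lemma exists_le_weighted_average (p : 'I_n -> R) (f : 'I_n -> R) b :
  (forall i, 0 <= p i) -> \sum_i p i = 1 -> \sum_i p i * f i <= b ->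
  exists i, f i <= b.
Proof.
move=> p0 p1 pfb.
have [i0 _] : exists i0 : 'I_n, true.
  case: n p f p0 p1 pfb => [|k] p f p0 p1 pfb; last by exists ord0.
  by move: p1; rewrite big_ord0 => /esym/eqP; rewrite oner_eq0.
have [i _ fi] := @Order.TotalTheory.arg_minP _ _ _ i0 xpredT f isT.
exists i; apply: le_trans pfb.
rewrite -[f i]mul1r -p1 mulr_suml ler_sum// => j _.
by rewrite ler_wpM2l ?p0// fi.
Qed.

(** When [i] is drawn with probability [|h_i|], the signed basis vector has mean [h]: the cross
    terms with [g] are those of [h], and only the variance, the last bracket, is added. *)
Lemma bform_average G h g : l1norm h = 1 ->
  \sum_i `|h i 0| * bform G (g + sgn_delta (i, h i 0 < 0))
                            (g + sgn_delta (i, h i 0 < 0)) =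
  bform G (g + h) (g + h) + (\sum_i `|h i 0| * G i i - bform G h h).
Proof.
move=> h1; transitivity (\sum_i (`|h i 0| * bform G g g +
    bform G g (`|h i 0| *: sgn_delta (i, h i 0 < 0)) +
    bform G (`|h i 0| *: sgn_delta (i, h i 0 < 0)) g + `|h i 0| * G i i)).
  apply: eq_bigr => i _.
  by rewrite bformDl !bformDr bform_sgn_delta (bformZl _ `|_|)
    (bformZr _ `|_|) /=; ring.
rewrite !big_split /= -bform_suml -bform_sumr sum_sgn_delta -mulr_suml.
by rewrite -/(l1norm h) h1 bformDl !bformDr; ring.
Qed.

(* A derandomized Maurey argument: the signed basis vectors, taken with
   probabilities [|h_i|], have mean [h], so that replacing one copy of [h] by
   one of them can be done at the price of the variance only. *)
Lemma maurey_sparsification G h (k : nat) w : l1norm h = 1 ->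
  exists s : k.-tuple ('I_n * bool),
    let v := w - h *+ k + \sum_(a <- s) sgn_delta a in
    bform G v v <= bform G w w + (\sum_i `|h i 0| * G i i - bform G h h) *+ k.
Proof.
move=> h1; set D := \sum_i _ - _; elim: k => [|k [s IH]].
  by exists [tuple]; rewrite big_nil !mulr0n subr0 !addr0.
move: IH; set v := (X in let v := X in _) => /= IH.
(* One more copy of [h] is taken out of [v]. Putting a signed basis vector in its place costs one
   variance term on average, hence at most that for some index. *)
pose g := v - h.
have avg : \sum_i `|h i 0| * bform G (g + sgn_delta (i, h i 0 < 0))
                               (g + sgn_delta (i, h i 0 < 0)) <=
    bform G v v + (\sum_i `|h i 0| * G i i - bform G h h).
  by rewrite bform_average// subrK.
have [i iP] := exists_le_weighted_average (fun i => normr_ge0 (h i 0)) h1 avg.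
exists [tuple of (i, h i 0 < 0) :: s].
rewrite big_cons.
have -> : w - h *+ k.+1 +
  (sgn_delta (i, h i 0 < 0) + \sum_(j <- s) sgn_delta j) =
  g + sgn_delta (i, h i 0 < 0).
  rewrite /g /v mulrS opprD (addrC (- h)) !addrA.
  by rewrite addrAC -!addrA; congr (_ + (_ + _)); rewrite addrC addrA [LHS]addrAC.
apply: (le_trans iP).
by rewrite [leRHS](_ : _ = bform G w w + D *+ k + D) ?lerD2r// mulrSr addrA.
Qed.

End maurey.

(** * Deterministic error bound on the kernel of a matrix *)

Section kernel_bound.
Context {R : realType} {m n : nat}.
Implicit Types (A : 'M[R]_(m, n)) (u v h : 'cV[R]_n).

Lemma dotprod_row A j v : dotprod (row j A)^T v = (A *m v) j 0.
Proof. by rewrite /dotprod mxE; apply: eq_bigr => i _; rewrite !mxE. Qed.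

(** The squared norm of [A v], split over the rows because these are the independent objects. *)
Definition energy A v : R := \sum_(j < m) dotprod (row j A)^T v ^+ 2.

Lemma energyE A v : energy A v = l2norm (A *m v) ^+ 2.
Proof. by rewrite sqr_l2norm; apply: eq_bigr => j _; rewrite dotprod_row. Qed.

Lemma energyZ A c v : energy A (c *: v) = c ^+ 2 * energy A v.
Proof. by rewrite !energyE -scalemxAr l2normZ exprMn real_normK ?num_real. Qed.

Lemma l2norm_delta (i : 'I_n) : l2norm (delta_mx i 0 : 'cV[R]_n) = 1.
Proof.
rewrite /l2norm (bigD1 i)//= big1 => [|j ji]; rewrite !mxE ?eqxx.
  by rewrite expr1n addr0 sqrtr1.
by rewrite (negbTE ji) expr0n.
Qed.

Lemma sqr_l2norm_mx p (v : 'cV[R]_p) : l2norm v ^+ 2 = (v^T *m v) 0 0.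
Proof. by rewrite sqr_l2norm mxE; apply: eq_bigr => i _; rewrite mxE expr2. Qed.

Lemma bform_energy A a v :
  bform (A^T *m A - a%:M) v v = energy A v - a * l2norm v ^+ 2.
Proof.
rewrite /bform mulmxBr mulmxBl mxE energyE !sqr_l2norm_mx trmx_mul !mulmxA.
by congr (_ + _); rewrite -scalemx1 -scalemxAr mulmx1 -scalemxAl !mxE.
Qed.

(** Indexing by tuples gives a finite family of [(2n)^k] members, ready for the union bound. *)
Definition signed_sum k (s : k.-tuple ('I_n * bool)) : 'cV[R]_n :=
  \sum_(a <- s) sgn_delta a.

(** For [|h|_1 = 1], replacing all copies in [k h] yields a signed sum with [0 <= Q <= - a k^2
    |h|_2^2 + k (b + a |h|_2^2)], where [Q] is the energy minus [a] times the squared norm. Dividing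
    by [k] leaves the factor [k - 1]. *)
Lemma kernel_l2norm_le A a b h k : 0 <= a -> (0 < k)%N -> A *m h = 0 ->
  (forall s : k.-tuple ('I_n * bool),
    a * l2norm (signed_sum s) ^+ 2 <= energy A (signed_sum s)) ->
  (forall i, energy A (delta_mx i 0) <= b) ->
  a * (k%:R - 1) * l2norm h ^+ 2 <= b * l1norm h ^+ 2.
Proof.
move=> a0 k0 + sparseA colA.
(* Both sides are homogeneous of degree 2 in [h], and [h = 0] is trivial. *)
wlog h1 : h / l1norm h = 1 => [wlg Ah|Ah].
  have [h0|h0] := eqVneq (l1norm h) 0.
    by rewrite h0 (l1norm_eq0 h0) /l2norm big1 ?sqrtr0 ?expr0n ?mulr0// => i _;
      rewrite mxE expr0n.
  have hp : 0 < l1norm h by rewrite lt_def h0 l1norm_ge0.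
  have := wlg ((l1norm h)^-1 *: h).
  rewrite l1normZ l2normZ gtr0_norm ?invr_gt0// mulVf// -scalemxAr Ah scaler0.
  move=> /(_ erefl erefl); rewrite expr1n mulr1 exprMn exprVn mulrCA mulrC.
  by rewrite ler_pdivrMr// exprn_gt0.
have [s] := @maurey_sparsification R n (A^T *m A - a%:M) h k (h *+ k) h1.
rewrite /= subrr add0r -/(signed_sum s) !bform_energy => sP.
have kR : 0 < k%:R :> R by rewrite ltr0n.
have e0 : energy A h = 0.
  by rewrite energyE Ah /l2norm big1 ?sqrtr0 ?expr0n// => i _; rewrite mxE expr0n.
have diag : \sum_i `|h i 0| * (A^T *m A - a%:M) i i <= b.
  rewrite -[leRHS]mul1r -h1 mulr_suml ler_sum// => i _.
  rewrite ler_wpM2l//.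
  have -> : (A^T *m A - a%:M) i i = energy A (delta_mx i 0) - a.
    rewrite -[LHS](@bform_sgn_delta _ _ _ (i, false)) /sgn_delta /= scale1r.
    by rewrite bform_energy l2norm_delta expr1n mulr1.
  by rewrite lerBlDr ler_wpDr// colA.
have := sparseA s; rewrite -subr_ge0 => /le_trans/(_ sP).
rewrite -scaler_nat energyZ l2normZ e0 exprMn ger0_norm ?ler0n//.
rewrite -[X in _ <= _ + X]mulr_natl.
have -> : k%:R ^+ 2 * 0 - a * (k%:R ^+ 2 * l2norm h ^+ 2) +
  k%:R * (\sum_i `|h i 0| * (A^T *m A - a%:M) i i - (0 - a * l2norm h ^+ 2)) =
  k%:R * (\sum_i `|h i 0| * (A^T *m A - a%:M) i i
          - a * (k%:R - 1) * l2norm h ^+ 2) by ring.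
rewrite pmulr_rge0// subr_ge0 => /le_trans; apply.
by rewrite h1 expr1n mulr1.
Qed.

(** No good event is needed: if a hypothesis of [kernel_l2norm_le] fails, the corresponding
    exponential is at least 1 and [|h|_2 <= |h|_1] suffices. The bound thus holds for every matrix
    and can be integrated directly. *)
Lemma kernel_l2norm_le_exp A h k (l t : R) : (1 <= m)%N -> (1 < k)%N ->
  0 < l -> 0 < t -> A *m h = 0 ->
  l2norm h <= l1norm h * (Num.sqrt (8 * t ^+ 2 / (k%:R - 1)) +
    (\sum_(s : k.-tuple ('I_n * bool) | signed_sum s != 0)
      expR (l * (m%:R / 4 -
                 energy A ((l2norm (signed_sum s))^-1 *: signed_sum s))) +
     \sum_(i < n) expR (energy A (delta_mx i 0) / t ^+ 2 - 2 * m%:R))).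
Proof.
move=> m0 k1 l0 t0 Ah.
set al := Num.sqrt _; set f := BIG_F; set g := (X in _ + (_ + X)).
have al0 : 0 <= al by exact: sqrtr_ge0.
have fs0 s : 0 <= f s by exact: expR_ge0.
have f0 : 0 <= \sum_(s : k.-tuple ('I_n * bool) | signed_sum s != 0) f s.
  by exact: sumr_ge0.
have g0 : 0 <= g by apply: sumr_ge0 => i _; exact: expR_ge0.
have h0 := l1norm_ge0 h.
have big b : 1 <= b -> l2norm h <= l1norm h * b.
  by move=> b1; rewrite (le_trans (l2norm_le_l1norm h))// ler_peMr.
have mR : 0 < m%:R :> R by rewrite ltr0n.
have k1R : 0 < k%:R - 1 :> R by rewrite subr_gt0 ltr1n.
have [colA|/existsNP[i /negP colA]] :=
    pselect (forall i, energy A (delta_mx i 0) <= 2 * t ^+ 2 * m%:R); last first.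
  apply: big; rewrite addrA ler_wpDl ?addr_ge0//.
  rewrite /g (bigD1 i)//= ler_wpDr ?sumr_ge0//.
  rewrite -[leLHS]expR0 ler_expR subr_ge0 ler_pdivlMr ?exprn_gt0// mulrAC.
  by rewrite ltW// ltNge.
have [sA|/existsNP[s /negP sA]] := pselect (forall s : k.-tuple ('I_n * bool),
    m%:R / 4 * l2norm (signed_sum s) ^+ 2 <= energy A (signed_sum s)); last first.
  (* A vanishing sum satisfies the lower bound with equality, so the offending one can be
     normalized. *)
  have s0 : signed_sum s != 0.
    apply: contra sA => /eqP s0; rewrite s0 energyE mulmx0 /l2norm.
    by rewrite !big1 ?sqrtr0 ?expr0n ?mulr0// => i _; rewrite mxE expr0n.
  apply: big; rewrite ler_wpDl// ler_wpDr//.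
  rewrite (bigD1 s)//= ler_wpDr ?sumr_ge0//.
  rewrite /f -[leLHS]expR0 ler_expR mulr_ge0 ?(ltW l0)// subr_ge0 energyZ exprVn mulrC.
  have n0 : 0 < l2norm (signed_sum s).
    by rewrite lt_def l2norm_ge0 andbT; apply: contra s0 => /eqP/l2norm_eq0 ->.
  rewrite ler_pdivrMr ?exprn_gt0//.
  by rewrite ltW// ltNge.
rewrite mulrDr ler_wpDr ?mulr_ge0 ?addr_ge0//.
(* Here [a = m / 4] and [b = 2 t^2 m], whose quotient is the [8 t^2] under the root. *)
have := kernel_l2norm_le (ltW (divr_gt0 mR (ltr0n _ 4))) (ltnW k1) Ah sA colA.
move=> hb.
rewrite -[leLHS]ger0_norm ?l2norm_ge0// -[l1norm h]ger0_norm//.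
rewrite -!sqrtr_sqr -sqrtrM ?sqr_ge0// ler_wsqrtr//.
rewrite mulrA ler_pdivlMr//.
rewrite -(ler_pM2l (divr_gt0 mR (ltr0n _ 4))).
by apply: le_trans (_ : _ <= 2 * t ^+ 2 * m%:R * l1norm h ^+ 2) _; lra.
Qed.

End kernel_bound.

(** * Expectations of products of functions of independent variables *)

Section independence.
Context {R : realType} {d : measure_display} {T : measurableType d}.
Context {d' : measure_display} {U : measurableType d'} (P : probability T R).

Import HBNNSimple.

(** The factorization passes from indicators to simple functions by linearity, then to [f] by
    monotone convergence. Taking [B] to be the whole space shows that [c] is the mean of [W]. *)
Lemma integral_indep_mul (W : T -> R) (Y : T -> U) (c : R)
    (f : U -> R) :
  measurable_fun setT W -> (forall w, 0 <= W w) -> measurable_fun setT Y ->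
  0 <= c -> measurable_fun setT f -> (forall y, 0 <= f y) ->
  (forall B, measurable B ->
    (\int[P]_w (W w * \1_B (Y w))%:E = c%:E * P (Y @^-1` B))%E) ->
  (\int[P]_w (W w * f (Y w))%:E = c%:E * \int[P]_w (f (Y w))%:E)%E.
Proof.
move=> mW W0 mY c0 mf f0 WY.
have mfE : measurable_fun setT (EFin \o f) by exact/measurable_EFinP.
pose g := nnsfun_approx measurableT mfE.
have mg n : measurable_fun setT (g n \o Y) by exact: measurableT_comp.
have ng n w : 0 <= g n (Y w) by exact: fun_ge0.
have simple n :
    (\int[P]_w (W w * g n (Y w))%:E = c%:E * \int[P]_w (g n (Y w))%:E)%E.
  have gE y := fimfunEord (g n) y; set s : seq R := finmap.enum_fset _ in gE.
  have s0 (i : 'I_(size s)) : 0 <= s`_i.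
    have := mem_nth 0 (ltn_ord i).
    by rewrite in_fset_set// inE => -[y _ <-]; exact: fun_ge0.
  have mB (i : 'I_(size s)) : measurable (g n @^-1` [set s`_i]).
    exact: measurable_sfunP.
  have m1 (i : 'I_(size s)) :
      measurable_fun setT (fun w => \1_(g n @^-1` [set s`_i]) (Y w) : R).
    by apply: measurableT_comp => //; exact: measurable_indic.
  under eq_integral => w _.
    rewrite gE mulr_sumr -sumEFin.
    under eq_bigr => i _ do rewrite mulrCA EFinM.
    over.
  rewrite ge0_integral_sum//=; last 2 first.
  - by move=> i; apply/measurable_EFinP; do 2 apply: measurable_funM => //.
  - by move=> i w _; rewrite lee_fin !mulr_ge0.
  under [in RHS]eq_integral => w _.
    rewrite gE -sumEFin.
    under eq_bigr => i _ do rewrite EFinM.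
    over.
  rewrite ge0_integral_sum//=; last 2 first.
  - by move=> i; apply/measurable_EFinP; apply: measurable_funM.
  - by move=> i w _; rewrite lee_fin !mulr_ge0.
  rewrite ge0_sume_distrr => [|i _]; last first.
    by apply: integral_ge0 => w _; rewrite lee_fin !mulr_ge0.
  apply: eq_bigr => i _.
  under eq_integral => w _ do rewrite EFinM.
  rewrite ge0_integralZl_EFin//; last 2 first.
  - by move=> w _; rewrite lee_fin !mulr_ge0.
  - by apply/measurable_EFinP; apply: measurable_funM.
  rewrite ge0_integralZl_EFin//; last exact/measurable_EFinP.
  rewrite WY// muleCA; congr (_ * (_ * _))%E.
  transitivity (\int[P]_w (\1_(Y @^-1` (g n @^-1` [set s`_i])) w)%:E)%E.
    by rewrite integral_indic ?setIT// -[X in measurable X]setTI; exact: mY.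
  by apply: eq_integral.
have gcvg w : (g n (Y w))%:E @[n --> \oo] --> (f (Y w))%:E.
  by apply: (@cvg_nnsfun_approx _ _ _ _ measurableT _ mfE) => // y _; exact: f0.
have nd w m n : (m <= n)%N -> g m (Y w) <= g n (Y w).
  by move=> mn; have /lefP := nd_nnsfun_approx measurableT mfE mn; exact.
have cvgl : (\int[P]_w (W w * g n (Y w))%:E @[n --> \oo] -->
             \int[P]_w (W w * f (Y w))%:E)%E.
  rewrite [X in _ --> X](_ : _ = \int[P]_w
      limn (fun n => (W w * g n (Y w))%:E))%E; last first.
    apply: eq_integral => w _; apply/esym/cvg_lim => //.
    under eq_fun do rewrite EFinM.
    by rewrite EFinM; apply: cvgeZl.
  apply: cvg_monotone_convergence => //.
  - by move=> n; apply/measurable_EFinP; exact: measurable_funM mW (mg n).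
  - by move=> n w _; rewrite lee_fin mulr_ge0.
  - by move=> w _ a b ab; rewrite lee_fin ler_wpM2l// nd.
have cvgr : (\int[P]_w (W w * g n (Y w))%:E @[n --> \oo] -->
             c%:E * \int[P]_w (f (Y w))%:E)%E.
  under eq_fun do rewrite simple.
  apply: cvgeZl => //.
  rewrite [X in _ --> X](_ : _ = \int[P]_w limn (fun n => (g n (Y w))%:E))%E; last first.
    by apply: eq_integral => w _; apply/esym/cvg_lim.
  apply: cvg_monotone_convergence => //.
  - by move=> n; apply/measurable_EFinP; exact: mg.
  - by move=> n w _; rewrite lee_fin.
  - by move=> w _ a b ab; rewrite lee_fin nd.
exact: cvg_unique cvgl cvgr.
Qed.

Lemma integral_prod_indep (m : nat) (Y : 'I_m -> T -> U)
    (f : 'I_m -> U -> R) (e : 'I_m -> R) :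
  (forall i, measurable_fun setT (Y i)) ->
  (forall B : 'I_m -> set U, (forall i, measurable (B i)) ->
    P (\bigcap_(i in setT) (Y i @^-1` B i)) = (\prod_i P (Y i @^-1` B i))%E) ->
  (forall i, measurable_fun setT (f i)) -> (forall i y, 0 <= f i y) ->
  (forall i, (\int[P]_w (f i (Y i w))%:E = (e i)%:E)%E) ->
  (\int[P]_w (\prod_i f i (Y i w))%:E = (\prod_i e i)%:E)%E.
Proof.
move=> mY indY.
have mYB i (B : set U) : measurable B -> measurable (Y i @^-1` B).
  by move=> mB; rewrite -[X in measurable X]setTI; exact: mY.
(* induction on the number of functions that need not be indicators *)
suff gen k : forall (f : 'I_m -> U -> R) (e : 'I_m -> R),
    (forall i, measurable_fun setT (f i)) ->
    (forall i y, 0 <= f i y) ->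
    (forall i, (\int[P]_w (f i (Y i w))%:E = (e i)%:E)%E) ->
    (forall i : 'I_m, (k <= i)%N -> exists2 B, measurable B & f i = \1_B) ->
    (\int[P]_w (\prod_i f i (Y i w))%:E = (\prod_i e i)%:E)%E.
  by move=> mf f0 fe; apply: (gen m) => // i; rewrite leqNgt ltn_ord.
elim: k => [|k IH] {}f {}e mf f0 fe fB.
  (* When all factors are indicators, their product is the indicator of an intersection, and
     independence of events applies. *)
  have /choice[B /all_and2[mB fE]] : forall i, exists B, measurable B /\ f i = \1_B.
    by move=> i; have [//|B mB ->] := fB i; exists B.
  have eE i : P (Y i @^-1` B i) = (e i)%:E.
    rewrite -fe -[X in P X]setIT -integral_indic//; last exact: mYB.
    by apply: eq_integral => w _; rewrite fE.
  transitivity (\int[P]_w (\1_(\bigcap_(i in setT) (Y i @^-1` B i)) w)%:E)%E.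
    apply: eq_integral => w _; congr EFin; rewrite indicE.
    have [wB|wB] := boolP (w \in _).
      rewrite big1// => i _; rewrite fE indicE mem_set//.
      by move: wB; rewrite inE; exact.
    have [i wi] : exists i, ~ B i (Y i w).
      by apply/existsNP => wB'; move: wB; rewrite notin_setE; apply => i _; exact: wB'.
    by rewrite (bigD1 i)//= fE indicE memNset// mul0r.
  rewrite integral_indic//; last first.
    by apply: fin_bigcap_measurable => [|i _]; [exact: finite_finset|exact: mYB].
  rewrite setIT -prodEFin; apply: etrans (indY B mB) _; apply: eq_bigr => i _; exact: eE.
have [km|mk] := ltnP k m; last first.
  by apply: IH => // i ki; have := leq_trans mk ki; rewrite leqNgt ltn_ord.
pose i0 := Ordinal km.
have prodE (F : 'I_m -> R) : \prod_i F i = (\prod_(i | i != i0) F i) * F i0.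
  by rewrite (bigD1 i0)//= mulrC.
under eq_integral => w _ do rewrite prodE.
have e0 i : 0 <= e i.
  by rewrite -lee_fin -fe; apply: integral_ge0 => w _; rewrite lee_fin.
rewrite (@integral_indep_mul _ _ (\prod_(i | i != i0) e i)) //.
- by rewrite fe -EFinM -prodE.
- under eq_fun do rewrite -big_filter.
  by apply: measurable_prod => i _; exact: measurableT_comp.
- by move=> w; apply: prodr_ge0.
- by apply: prodr_ge0.
move=> B mB.
(* The factor at [i0] is split off, and its factorization has to be checked on indicators only.
   Substituting [\1_B] for it leaves one non-indicator fewer, so the induction hypothesis
   applies. *)
pose f' i := if i == i0 then \1_B else f i : U -> R.
pose e' i := if i == i0 then fine (P (Y i0 @^-1` B)) else e i.
have finP : P (Y i0 @^-1` B) \is a fin_num by apply: fin_num_measure; exact: mYB.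
transitivity (\prod_i e' i)%:E; last first.
  rewrite prodE {2}/e' eqxx EFinM fineK//; congr (_%:E * _)%E.
  by apply: eq_bigr => i /negbTE ii0; rewrite /e' ii0.
rewrite -(IH f').
- apply: eq_integral => w _; rewrite prodE {2}/f' eqxx; congr (_ * _)%:E.
  by apply: eq_bigr => i /negbTE ii0; rewrite /f' ii0.
- move=> i; rewrite /f'; case: ifP => // _; exact: measurable_indic.
- by move=> i y; rewrite /f'; case: ifP.
- move=> i; rewrite /f' /e'; case: ifPn => [/eqP ->|_]; last exact: fe.
  rewrite fineK//; transitivity (\int[P]_w (\1_(Y i0 @^-1` B) w)%:E)%E => //.
  by rewrite integral_indic ?setIT//; exact: mYB.
- move=> i ki; rewrite /f'; case: ifPn => [_|ii0]; first by exists B.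
  by apply: fB; rewrite ltn_neqAle ki andbT eq_sym.
Qed.

End independence.

(** * Borel measurability on column vectors *)

Section borel_vectors.
Context {R : realType} {n : nat}.

(** Column vectors as a measurable type whose measurable sets are, up to conversion, those of
    [borel_cV]. *)
Definition cV_borelType := g_sigma_algebraType
  (\big[setU/set0]_(i < n) preimage_set_system setT
    (fun v : 'cV[R]_n => v i 0 : measurableTypeR R) measurable).

Lemma measurable_coord (i : 'I_n) :
  measurable_fun setT (fun v : cV_borelType => v i 0 : R).
Proof.
move=> _ B mB; apply: sub_sigma_algebra.
by rewrite (bigD1 i)//=; left; exists B.
Qed.

Lemma measurable_dotprod (u : 'cV[R]_n) :
  measurable_fun setT (fun v : cV_borelType => dotprod v u).
Proof.
apply: measurable_sum => i; apply: measurable_funM => //.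
exact: measurable_coord.
Qed.

Lemma measurable_l2normB (x : 'cV[R]_n) :
  measurable_fun setT (fun v : cV_borelType => l2norm (v - x)).
Proof.
apply: (measurableT_comp (f := @Num.sqrt R)).
  by apply: continuous_measurable_fun; exact: sqrt_continuous.
apply: measurable_sum => i; apply: measurable_funX.
rewrite (_ : (fun _ => _) = (fun v : cV_borelType => v i 0 - x i 0)); last first.
  by apply/funext => v; rewrite !mxE.
by apply: measurable_funD => //; exact: measurable_coord.
Qed.

Context {d : measure_display} {T : measurableType d}.

Lemma measurable_random_vector (X : T -> cV_borelType) :
  random_vector X -> measurable_fun setT X.
Proof. by move=> mX _ B mB; rewrite setTI; exact: mX. Qed.

End borel_vectors.
Arguments cV_borelType R n : clear implicits.

(** * Moments and Laplace transforms of the marginals of one row *)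

Section moments.
Context {R : realType} {d : measure_display} {T : measurableType d}.
Context (P : probability T R) {n : nat} {X : T -> 'cV[R]_n}.
Hypothesis mX : random_vector X.

Lemma measurable_marginal (u : 'cV[R]_n) :
  measurable_fun setT (fun w => dotprod (X w) u).
Proof.
exact: (measurableT_comp (measurable_dotprod u) (measurable_random_vector mX)).
Qed.

Lemma measurable_component (i : 'I_n) : measurable_fun setT (fun w => X w i 0).
Proof.
exact: (measurableT_comp (measurable_coord i) (measurable_random_vector mX)).
Qed.

Lemma isotropicE : isotropic P X ->
  forall j k, (\int[P]_w (X w j 0 * X w k 0)%:E = ((j == k)%:R : R)%:E)%E.
Proof.
move=> iso j k; have := iso j k; rewrite unlock mxE => <-.
by apply: eq_integral => w _; rewrite !mxE big_ord1 !mxE.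
Qed.

(** The squares have finite integrals by isotropy, and [|a b| <= a^2 + b^2] dominates the mixed
    products. Expanding a second moment linearly requires this. *)
Lemma isotropic_integrable : isotropic P X ->
  forall j k, P.-integrable setT (fun w => (X w j 0 * X w k 0)%:E).
Proof.
move=> iso.
have mM j k : measurable_fun setT (fun w => X w j 0 * X w k 0).
  by apply: measurable_funM; exact: measurable_component.
have sq j : P.-integrable setT (fun w => (X w j 0 * X w j 0)%:E).
  apply/integrableP; split; first by apply/measurable_EFinP; exact: mM.
  under eq_integral => w _ do rewrite gee0_abs ?lee_fin -?expr2 ?sqr_ge0// expr2.
  by rewrite isotropicE// ltry.
move=> j k; apply: le_integrable (integrableD measurableT (sq j) (sq k)) => //.
  by apply/measurable_EFinP; exact: mM.
move=> w _ /=; rewrite lee_fin normrM.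
rewrite [leRHS]ger0_norm; last by rewrite addr_ge0 // -expr2 sqr_ge0.
rewrite -!expr2 -[X w j 0 ^+ 2]real_normK ?num_real//.
rewrite -[X w k 0 ^+ 2]real_normK ?num_real//.
have := sqr_ge0 (`|X w j 0| - `|X w k 0|).
have := mulr_ge0 (normr_ge0 (X w j 0)) (normr_ge0 (X w k 0)).
lra.
Qed.

Lemma isotropic_second_moment (u : 'cV[R]_n) : isotropic P X ->
  (\int[P]_w (dotprod (X w) u ^+ 2)%:E = (l2norm u ^+ 2)%:E)%E.
Proof.
move=> iso; have intX := isotropic_integrable iso.
transitivity (\int[P]_w \sum_(p : 'I_n * 'I_n)
    ((u p.1 0 * u p.2 0)%:E * (X w p.1 0 * X w p.2 0)%:E))%E.
  apply: eq_integral => w _; under [RHS]eq_bigr do rewrite -EFinM.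
  rewrite sumEFin; congr EFin; rewrite -(pair_bigA _ (fun j k =>
    u j 0 * u k 0 * (X w j 0 * X w k 0)))/= expr2 /dotprod mulr_suml.
  apply: eq_bigr => j _; rewrite mulr_sumr; apply: eq_bigr => k _.
  by ring.
rewrite integral_sum//; last by move=> p; exact: integrableZl.
under eq_bigr do rewrite integralZl// isotropicE// -EFinM.
rewrite sumEFin -(pair_bigA _ (fun j k => u j 0 * u k 0 * (j == k)%:R))/=.
rewrite sqr_l2norm; congr EFin; apply: eq_bigr => j _.
rewrite (bigD1 j)//= eqxx mulr1 big1 ?addr0// => k.
by rewrite eq_sym => /negbTE ->; rewrite mulr0.
Qed.

(** The infimum supplies an admissible scale [r < t], and the exponential moment decreases as the
    scale grows. The strict inequality [L < t] avoids asking whether the infimum is attained. *)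
Lemma psi2_norm_vector_le (u : 'cV[R]_n) (L t : R) :
  (psi2_norm_vector P X <= L%:E)%E -> L < t -> l2norm u = 1 ->
  (\int[P]_w (expR (dotprod (X w) u ^+ 2 / t ^+ 2))%:E <= 2%:E)%E.
Proof.
move=> XL Lt u1.
have : (psi2_norm P (fun w => dotprod (X w) u) < t%:E)%E.
  apply: (@le_lt_trans _ _ L%:E); last by rewrite lte_fin.
  by apply: le_trans XL; apply: ereal_sup_ubound; exists u.
move=> /ereal_inf_lt[_ [r [r0 +] <-]]; rewrite lte_fin unlock => rX rt.
apply: le_trans rX; apply: ge0_le_integral => //.
- apply/measurable_EFinP; apply: measurableT_comp => //.
  by apply: measurable_funM => //; apply: measurable_funX; exact: measurable_marginal.
- apply/measurable_EFinP; apply: measurableT_comp => //.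
  by apply: measurable_funM => //; apply: measurable_funX; exact: measurable_marginal.
- move=> w _; rewrite lee_fin ler_expR ler_wpM2l ?sqr_ge0//.
  have t0 := lt_trans r0 rt.
  by rewrite lef_pV2 ?posrE ?exprn_gt0// lerXn2r ?nnegrE ?ltW.
Qed.

(** Since [expR y >= (1 + y/2)^2], it is enough that the right side times this square is at least 1.
    The coefficient 3/4 makes the quadratic term of that product vanish. *)
Lemma expRN_le (y : R) : 0 <= y -> expR (- y) <= 1 - y + 3 / 4 * y ^+ 2.
Proof.
move=> y0; have y20 : 0 <= y / 2 by rewrite divr_ge0.
have : (1 + y / 2) ^+ 2 <= expR y.
  rewrite (_ : expR y = expR (y / 2) ^+ 2); last by rewrite -expRM_natr divfK.
  by rewrite lerXn2r ?nnegrE ?expR_ge0 ?addr_ge0// expR_ge1Dx.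
move=> ey; rewrite expRN.
apply: (@le_trans _ _ ((1 + y / 2) ^+ 2)^-1).
  by rewrite lef_pV2 ?posrE ?expR_gt0// exprn_gt0// ltr_pwDl.
rewrite -[leLHS]mul1r ler_pdivrMr; last by rewrite exprn_gt0// ltr_pwDl.
have -> : (1 - y + 3 / 4 * y ^+ 2) * (1 + y / 2) ^+ 2 =
  1 + y ^+ 3 / 2 + 3 / 16 * y ^+ 4 by field.
have := exprn_ge0 3 y0; have := exprn_ge0 4 y0; lra.
Qed.

(* The second moment is bounded below and the fourth one above, which controls
   the Laplace transform of the square near [0]. *)
Lemma laplace_sqr_marginal (u : 'cV[R]_n) (t l : R) :
  0 < t -> l = (6 * t ^+ 4)^-1 -> isotropic P X -> l2norm u = 1 ->
  (\int[P]_w (expR (dotprod (X w) u ^+ 2 / t ^+ 2))%:E <= 2%:E)%E ->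
  (\int[P]_w (expR (- (l * dotprod (X w) u ^+ 2)))%:E <= (expR (- (l / 2)))%:E)%E.
Proof.
move=> t0 lE iso u1 ut.
have l0 : 0 < l by rewrite lE invr_gt0 mulr_gt0// exprn_gt0.
have t4 : l * t ^+ 4 = 6^-1.
  by rewrite lE; field; rewrite gt_eqF.
set Z := fun w => dotprod (X w) u ^+ 2.
have mZ : measurable_fun setT Z.
  by apply: measurable_funX; exact: measurable_marginal.
have mE a : measurable_fun setT (fun w => expR (a * Z w)).
  by apply: measurableT_comp => //; exact: measurable_funM.
have mE1 : measurable_fun setT (fun w => expR (- (l * Z w))).
  by under eq_fun do rewrite -mulNr; exact: mE.
have mE2 : measurable_fun setT (fun w => expR (Z w / t ^+ 2)).
  by under eq_fun do rewrite mulrC; exact: mE.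
have Z0 w : 0 <= Z w by exact: sqr_ge0.
have lZ w : 0 <= l * Z w by rewrite pmulr_rge0.
(* The value of [l] gives [3 l t^4 = 1/2], so [z^2 / 2 <= expR z] at [z = Z / t^2] absorbs the
   quadratic error of [expRN_le]. The linear term stays on the left to keep both integrands
   nonnegative. *)
have ptw w : expR (- (l * Z w)) + l * Z w <= 1 + l / 4 * expR (Z w / t ^+ 2).
  have Zt : 0 <= Z w / t ^+ 2 by rewrite divr_ge0// exprn_ge0// ltW.
  have e1 := expRN_le (lZ w); have := expR_ge1Dxn 1 Zt.
  rewrite !factS fact0 => e2.
  suff : 3 / 4 * (l * Z w) ^+ 2 <= l / 4 * expR (Z w / t ^+ 2) by lra.
  have -> : 3 / 4 * (l * Z w) ^+ 2 = l / 4 * (3 * (l * t ^+ 4) * (Z w / t ^+ 2) ^+ 2).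
    by field; rewrite gt_eqF.
  rewrite ler_pM2l ?divr_gt0// t4; lra.
have : (\int[P]_w (expR (- (l * Z w)) + l * Z w)%:E <=
    \int[P]_w (1 + l / 4 * expR (Z w / t ^+ 2))%:E)%E.
  apply: ge0_le_integral => //.
  - by move=> w _; rewrite lee_fin addr_ge0 ?expR_ge0 ?lZ.
  - by apply/measurable_EFinP; apply: measurable_funD => //; exact: measurable_funM.
  - by apply/measurable_EFinP; apply: measurable_funD => //; exact: measurable_funM.
  - by move=> w _; rewrite lee_fin.
under eq_integral do rewrite EFinD EFinM.
under [in leRHS]eq_integral do rewrite EFinD EFinM.
rewrite ge0_integralD//; last 3 first.
- exact/measurable_EFinP.
- by move=> w _; rewrite -EFinM lee_fin lZ.
- by apply/measurable_EFinP; exact: measurable_funM.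
rewrite ge0_integralD//; last 2 first.
- by move=> w _; rewrite -EFinM lee_fin mulr_ge0 ?divr_ge0 ?expR_ge0 ?(ltW l0).
- by apply/measurable_EFinP; exact: measurable_funM.
rewrite !ge0_integralZl_EFin//; last first.
- exact: ltW.
- exact/measurable_EFinP.
- by move=> w _; rewrite lee_fin.
- by rewrite divr_ge0// ltW.
- exact/measurable_EFinP.
rewrite isotropic_second_moment// u1 expr1n mule1 integral_cst//.
rewrite [X in (1 * X)%E](_ : _ = 1%E) ?mule1; last exact: probability_setT.
move=> H; have {H} : (\int[P]_w (expR (- (l * Z w)))%:E + l%:E <= 1 + (l / 4)%:E * 2%:E)%E.
  by apply: (le_trans H); rewrite leeD2l// lee_pmul2l// lte_fin divr_gt0.
(* What remains is [1 + l/2 - l = 1 - l/2 <= expR (- (l/2))]. *)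
rewrite -EFinM -EFinD -leeBrDr// -EFinB => /le_trans; apply.
rewrite lee_fin; have := expR_ge1Dx (- (l / 2)); lra.
Qed.

End moments.

(** * Numerical inequalities and the choice of the sparsity level *)

Section numeric.
Context {R : realType}.

Lemma ln_ge_half (n : nat) : (2 <= n)%N -> 1 / 2 <= ln n%:R :> R.
Proof.
move=> n2; have n0 : 0 < n%:R :> R by rewrite ltr0n (leq_trans _ n2).
rewrite -ler_expR lnK ?posrE//; apply: (@le_trans _ _ 2); last by rewrite ler_nat.
have := expR_ge1Dx (- (1 / 2) : R); rewrite expRN => h.
rewrite -[leLHS]invrK -[leRHS]invrK lef_pV2 ?posrE ?invr_gt0 ?expR_gt0//.
by apply: le_trans h; lra.
Qed.

(** Brings the exponentially small terms down to the order of the main one, a square root of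
    [ln n / m]. *)
Lemma expRN_le_sqrtV (y : R) : 0 < y -> expR (- y) <= Num.sqrt y^-1.
Proof.
move=> y0; rewrite -[leLHS]ger0_norm ?expR_ge0// -sqrtr_sqr ler_wsqrtr//.
rewrite -expRM_natr mulNr expRN lef_pV2 ?posrE ?expR_gt0//.
by have := expR_ge1Dx (y * 2); lra.
Qed.

(** For [q > 1/2] there are too few measurements and the trivial error bound is good enough.
    Otherwise [k] is the integer part of [1/q], of order [m / ln n]: large enough for the Maurey
    term, small enough for the union bound. *)
Lemma sparsity_tradeoff (t l c : R) (n m : nat) :
  0 < l -> 0 < c -> c <= l / 16 -> c <= 1 -> (2 <= n)%N -> (1 <= m)%N ->
  let q := ln n%:R / (c * m%:R) in
  1 <= 2 * Num.sqrt q \/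
  exists2 k : nat, (1 < k)%N &
    Num.sqrt (8 * t ^+ 2 / (k%:R - 1)) +
      (((n * 2) ^ k)%:R * expR (- (l * m%:R / 4)) + n%:R * expR (- m%:R))
    <= (Num.sqrt (32 * t ^+ 2) + 3) * Num.sqrt q.
Proof.
move=> l0 c0 cl c1 n2 m1 q.
have m0 : 0 < m%:R :> R by rewrite ltr0n.
have cm0 : 0 < c * m%:R by exact: mulr_gt0.
have ln2 := ln_ge_half n2; set N := ln _ in ln2 q *.
have N0 : 0 < N by lra.
have n0 : 0 < n%:R :> R by rewrite ltr0n (leq_trans _ n2).
have nE : n%:R = expR N by rewrite lnK ?posrE.
have q0 : 0 < q by exact: divr_gt0.
have [q2|q2] := ltP 2^-1 q.
  left; rewrite -(@ger0_norm _ 2)// -sqrtr_sqr -sqrtrM ?sqr_ge0//.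
  by rewrite -[leLHS]sqrtr1 ler_wsqrtr//; lra.
right; set X := q^-1.
have X2 : 2 <= X by rewrite -[leLHS]invrK lef_pV2 ?posrE ?invr_gt0.
have X0 : 0 <= X by lra.
have XN : X * N = c * m%:R by rewrite /X /q invf_div divfK// gt_eqF.
have /andP[kX Xk] := truncn_itv X0; rewrite -natr1 in Xk.
have k2 : (2 <= Num.truncn X)%N by rewrite truncn_ge_nat.
exists (Num.truncn X) => //; set k := Num.truncn X in kX Xk k2 *.
have k2R : 2 <= k%:R :> R by rewrite (ler_nat R 2 k).
(* From [X < k + 1] and [k >= 2]; the factor 4 turns [8 t^2] into [32 t^2]. *)
have k1 : X / 4 <= k%:R - 1 by lra.
rewrite [leRHS](_ : _ = Num.sqrt (32 * t ^+ 2) * Num.sqrt q +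
  (Num.sqrt q + 2 * Num.sqrt q)); last by ring.
apply: lerD; [|apply: lerD].
- rewrite -sqrtrM; last by rewrite mulr_ge0 ?sqr_ge0.
  rewrite ler_wsqrtr// ler_pdivrMr; last by lra.
  apply: (@le_trans _ _ (32 * t ^+ 2 * q * (X / 4))).
    rewrite [leRHS](_ : _ = 8 * t ^+ 2 * (q * X)); last by field.
    by rewrite divff ?mulr1// gt_eqF.
  apply: ler_wpM2l => //; apply: mulr_ge0; last exact: ltW.
  by apply: mulr_ge0; [|exact: sqr_ge0].
(* As [2 <= n], [(2n)^k <= expR (2 k ln n) <= expR (2 c m) <= expR (l m / 8)]: the count consumes
   half of the exponent [l m / 4]. *)
- apply: (@le_trans _ _ (expR (- (l * m%:R / 8)))).
    have : (((n * 2) ^ k)%:R : R) <= expR (N * 2 * k%:R).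
      rewrite natrX expRM_natr lerXn2r ?nnegrE ?expR_ge0//.
      rewrite natrM expRM_natr expr2 -nE ler_wpM2l ?(ltW n0)//.
      by rewrite (ler_nat R 2 n).
    move=> /(ler_wpM2r (expR_ge0 (- (l * m%:R / 4)))) /le_trans; apply.
    rewrite -expRD ler_expR.
    have : N * k%:R <= c * m%:R by rewrite -XN mulrC ler_wpM2r// ltW.
    have : c * m%:R <= l / 16 * m%:R by rewrite ler_wpM2r// ltW.
    by lra.
  have lm0 : 0 < l * m%:R / 8 by rewrite divr_gt0// mulr_gt0.
  apply: (le_trans (expRN_le_sqrtV lm0)); rewrite ler_wsqrtr//.
  rewrite /q ler_pdivlMr// ler_pdivrMl//.
  have : c * m%:R <= l / 16 * m%:R by rewrite ler_wpM2r// ltW.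
  have : 1 / 2 * (l * m%:R / 8) <= N * (l * m%:R / 8) by rewrite ler_wpM2r// ltW.
  by lra.
(* Here [2 ln n <= X ln n = c m <= m], so the factor [n] is at most [expR (m / 2)]. *)
- apply: (@le_trans _ _ (expR (- (m%:R / 2)))).
    rewrite nE -expRD ler_expR.
    have : 2 * N <= X * N by rewrite ler_wpM2r// ltW.
    have : c * m%:R <= 1 * m%:R by rewrite ler_wpM2r// ltW.
    by rewrite XN; lra.
  have m20 : 0 < m%:R / 2 :> R by rewrite divr_gt0.
  apply: (le_trans (expRN_le_sqrtV m20)).
  have -> : 2 * Num.sqrt q = Num.sqrt (2 ^+ 2 * q).
    by rewrite (sqrtrM q) ?sqr_ge0// sqrtr_sqr ger0_norm.
  rewrite ler_wsqrtr//.
  rewrite /q mulrA ler_pdivlMr//.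
  rewrite (_ : _ * (c * m%:R) = 2 * c); first by lra.
  by field; rewrite gt_eqF.
Qed.

End numeric.

(** * Tails of the energy and the expected error for a random matrix *)

Section random_matrix.
Context {R : realType} {d : measure_display} {T : measurableType d}.
Context (P : probability T R) {n m : nat} {A : T -> 'M[R]_(m, n)}.
Hypothesis mA : forall i, random_vector (random_row A i).
Hypothesis indA : independent_vectors P (random_row A).

Lemma integral_prod_rows_le (f : cV_borelType R n -> R) (c : R) :
  measurable_fun setT f -> (forall v, 0 <= f v) ->
  (forall i, (\int[P]_w (f (random_row A i w))%:E <= c%:E)%E) ->
  (\int[P]_w (\prod_i f (random_row A i w))%:E <= (c ^+ m)%:E)%E.
Proof.
move=> mf f0 fc.
have i0 i : (0 <= \int[P]_w (f (random_row A i w))%:E)%E.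
  by apply: integral_ge0 => w _; rewrite lee_fin f0.
have fin i : (\int[P]_w (f (random_row A i w))%:E)%E \is a fin_num.
  by rewrite ge0_fin_numE// (le_lt_trans (fc i))// ltry.
have := @integral_prod_indep _ _ _ _ (cV_borelType R n) P m (random_row A)
  (fun=> f) (fun i => fine (\int[P]_w (f (random_row A i w))%:E)%E).
move=> ->//.
- rewrite lee_fin -[X in c ^+ X](card_ord m) -prodr_const ler_prod// => i _.
  by rewrite fine_ge0//= -lee_fin fineK.
- by move=> i; exact: measurable_random_vector (mA i).
- move=> B mB; have := indA (J := [set: 'I_m]%SET) (fun i _ => mB i).
  rewrite (_ : [set` _] = setT); last by apply/seteqP; split => i //=; rewrite inE.
  by move=> ->; apply: eq_bigl => i; rewrite inE.
- by move=> i; rewrite fineK.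
Qed.

Variables (L : R).
Hypothesis isoA : forall i, isotropic P (random_row A i).
Hypothesis psiA : forall i, (psi2_norm_vector P (random_row A i) <= L%:E)%E.

Lemma measurable_energy u : measurable_fun setT (fun w => energy (A w) u).
Proof.
apply: measurable_sum => i; apply: measurable_funX.
exact: (measurable_marginal (mA i)).
Qed.

(** The exponential of the energy factors over the independent rows. The sign of [a] is free, so
    both tails follow, with [b] carrying the threshold. *)
Lemma energy_laplace_le (a b c : R) u :
  (forall i, (\int[P]_w (expR (a * dotprod (random_row A i w) u ^+ 2))%:E <=
    (expR c)%:E)%E) ->
  (\int[P]_w (expR (a * energy (A w) u + b))%:E <= (expR (c * m%:R + b))%:E)%E.
Proof.
move=> ac.
pose f (v : cV_borelType R n) := expR (a * dotprod v u ^+ 2).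
have mf : measurable_fun setT f.
  apply: measurableT_comp => //; apply: measurable_funM => //.
  by apply: measurable_funX; exact: measurable_dotprod.
have fE w : expR (a * energy (A w) u + b) =
    expR b * \prod_i f (random_row A i w).
  by rewrite addrC expRD /f -expR_sum mulr_sumr.
under eq_integral do rewrite fE EFinM.
rewrite ge0_integralZl_EFin ?expR_ge0//; last 2 first.
- by move=> w _; rewrite lee_fin prodr_ge0// => i _; exact: expR_ge0.
- apply/measurable_EFinP; apply: measurable_prod => i _.
  exact: (measurableT_comp mf (measurable_random_vector (mA i))).
rewrite addrC expRD EFinM lee_wpmul2l ?lee_fin ?expR_ge0// expRM_natr.
by apply: integral_prod_rows_le => // v; exact: expR_ge0.
Qed.

(** Each row contributes a factor [expR (- (l/2))]; the threshold [m / 4] uses up half of the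
    resulting exponent [l m / 2]. *)
Lemma energy_lower_tail (t l : R) u : L < t -> 0 < t -> l = (6 * t ^+ 4)^-1 ->
  l2norm u = 1 ->
  (\int[P]_w (expR (l * (m%:R / 4 - energy (A w) u)))%:E <=
    (expR (- (l * m%:R / 4)))%:E)%E.
Proof.
move=> Lt t0 lE u1.
have -> : expR (- (l * m%:R / 4)) = expR (- (l / 2) * m%:R + l * m%:R / 4).
  by congr expR; field.
under eq_integral => w _.
  rewrite (_ : l * _ = - l * energy (A w) u + l * m%:R / 4); first over.
  by field.
apply: energy_laplace_le => i; under eq_integral do rewrite mulNr.
apply: (laplace_sqr_marginal (mA i) t0 lE (isoA i) u1).
exact: (psi2_norm_vector_le (mA i) (psiA i) Lt u1).
Qed.

(** Each row contributes at most [2 <= expR 1], hence [expR m] in total against [expR (- 2 m)]. *)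
Lemma energy_upper_tail (t : R) u : L < t -> l2norm u = 1 ->
  (\int[P]_w (expR (energy (A w) u / t ^+ 2 - 2 * m%:R))%:E <=
    (expR (- m%:R))%:E)%E.
Proof.
move=> Lt u1.
rewrite (_ : - m%:R = 1 * m%:R + - (2 * m%:R)); last by ring.
under eq_integral do rewrite mulrC.
apply: energy_laplace_le => i; under eq_integral do rewrite mulrC.
apply: le_trans (psi2_norm_vector_le (mA i) (psiA i) Lt u1) _.
by rewrite lee_fin; have := expR_ge1Dx (1 : R).
Qed.

Lemma integral_cst_probability (c : R) : (\int[P]__ c%:E = c%:E)%E.
Proof.
rewrite integral_cst//; transitivity (c%:E * 1)%E; last by rewrite mule1.
by congr (_ * _)%E; exact: probability_setT.
Qed.

Lemma ae_integral_le (g h : T -> R) (b : R) :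
  measurable_fun setT g -> (forall w, 0 <= g w) ->
  measurable_fun setT h -> (forall w, 0 <= h w) ->
  {ae P, forall w, g w <= h w} ->
  (\int[P]_w (h w)%:E <= b%:E)%E -> (\int[P]_w (g w)%:E <= b%:E)%E.
Proof.
move=> mg g0 mh h0 gh; apply: le_trans; apply: ae_ge0_le_integral => //.
- by move=> w _; rewrite lee_fin.
- exact/measurable_EFinP.
- by move=> w _; rewrite lee_fin.
- exact/measurable_EFinP.
- by apply: filterS gh => w gw _; rewrite lee_fin.
Qed.

Variables (x : 'cV[R]_n) (xhat : T -> 'cV[R]_n).
Hypothesis mxhat : random_vector xhat.
Hypothesis xhatP :
  {ae P, forall w, l1_min_solution (A w) (A w *m x) (xhat w)}.

(** The vector [x] is itself feasible, so [|z|_1 <= |x|_1] and the triangle inequality concludes. *)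
Lemma l1_min_solution_error (B : 'M[R]_(m, n)) (z : 'cV[R]_n) :
  l1_min_solution B (B *m x) z ->
  B *m (z - x) = 0 /\ l1norm (z - x) <= 2 * l1norm x.
Proof.
move=> [Bz zmin]; rewrite mulmxBr -Bz subrr; split=> //.
by apply: (le_trans (ler_l1normB _ _)); have := zmin x erefl; lra.
Qed.

Lemma measurable_error : measurable_fun setT (fun w => l2norm (xhat w - x)).
Proof.
exact: (measurableT_comp (measurable_l2normB x) (measurable_random_vector mxhat)).
Qed.

(** The trivial bound, for the case where [m] is small compared with [ln n]. *)
Lemma expected_error_le_l1norm :
  ('E_P[fun w => l2norm (xhat w - x)] <= (2 * l1norm x)%:E)%E.
Proof.
rewrite unlock; apply: (@ae_integral_le _ (fun=> 2 * l1norm x)) => //.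
- exact: measurable_error.
- by move=> w; exact: l2norm_ge0.
- by move=> w; rewrite mulr_ge0// l1norm_ge0.
- apply: filterS xhatP => w /l1_min_solution_error[_].
  exact: le_trans (l2norm_le_l1norm _).
- by rewrite integral_cst_probability.
Qed.

Lemma expected_error_le (t l : R) (k : nat) :
  (1 <= m)%N -> (1 < k)%N -> L < t -> 0 < t -> l = (6 * t ^+ 4)^-1 ->
  ('E_P[fun w => l2norm (xhat w - x)] <= (2 * l1norm x *
    (Num.sqrt (8 * t ^+ 2 / (k%:R - 1)) +
      (((n * 2) ^ k)%:R * expR (- (l * m%:R / 4)) + n%:R * expR (- m%:R))))%:E)%E.
Proof.
move=> m1 k1 Lt t0 lE; set al := Num.sqrt _.
have l0 : 0 < l by rewrite lE invr_gt0 mulr_gt0// exprn_gt0.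
(* The value 0 at vanishing sums makes the unrestricted sum of [F] agree with the restricted one in
   [kernel_l2norm_le_exp]. *)
pose F (s : k.-tuple ('I_n * bool)) w := if signed_sum s != 0 :> 'cV[R]_n
  then expR (l * (m%:R / 4 -
    energy (A w) ((l2norm (signed_sum s))^-1 *: signed_sum s))) else 0.
pose G (i : 'I_n) w := expR (energy (A w) (delta_mx i 0) / t ^+ 2 - 2 * m%:R).
have F0 s w : 0 <= F s w by rewrite /F; case: ifP => // _; exact: expR_ge0.
have G0 i w : 0 <= G i w by exact: expR_ge0.
have mF s : measurable_fun setT (F s).
  rewrite /F; case: (_ != _) => //; apply: measurableT_comp => //.
  apply: measurable_funM => //; apply: measurable_funB => //.
  exact: measurable_energy.
have mG i : measurable_fun setT (G i).
  apply: measurableT_comp => //; apply: measurable_funB => //.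
  by apply: measurable_funM => //; exact: measurable_energy.
have intF s : (\int[P]_w (F s w)%:E <= (expR (- (l * m%:R / 4)))%:E)%E.
  rewrite /F; case: (boolP (_ != _)) => [s0|_]; last first.
    by rewrite integral0 lee_fin expR_ge0.
  have n0 : 0 < l2norm (signed_sum s : 'cV[R]_n).
    by rewrite lt_def l2norm_ge0 andbT; apply: contra s0 => /eqP/l2norm_eq0 ->.
  apply: (energy_lower_tail Lt t0 lE).
  by rewrite l2normZ gtr0_norm ?invr_gt0// mulVf// gt_eqF.
have intG i : (\int[P]_w (G i w)%:E <= (expR (- m%:R))%:E)%E.
  by apply: energy_upper_tail => //; exact: l2norm_delta.
have x0 : 0 <= 2 * l1norm x by rewrite mulr_ge0// l1norm_ge0.
have S0 w : 0 <= al + (\sum_s F s w + \sum_i G i w).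
  by rewrite !addr_ge0 ?sqrtr_ge0 ?sumr_ge0.
have mS : measurable_fun setT (fun w => \sum_s F s w) by exact: measurable_sum.
have mS' : measurable_fun setT (fun w => \sum_i G i w) by exact: measurable_sum.
rewrite unlock; apply: (@ae_integral_le _ (fun w => 2 * l1norm x *
    (al + (\sum_s F s w + \sum_i G i w)))).
- exact: measurable_error.
- by move=> w; exact: l2norm_ge0.
- apply: measurable_funM => //; apply: measurable_funD => //.
  exact: measurable_funD.
- by move=> w; rewrite mulr_ge0.
- apply: filterS xhatP => w /l1_min_solution_error[Ah h1].
  apply: (le_trans (kernel_l2norm_le_exp m1 k1 l0 t0 Ah)).
  by rewrite [X in _ * (_ + (X + _))]big_mkcond; exact: (ler_wpM2r (S0 w) h1).
under eq_integral do rewrite EFinM.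
rewrite ge0_integralZl_EFin//; last 2 first.
- by move=> w _; rewrite lee_fin.
- by apply/measurable_EFinP; apply: measurable_funD => //; exact: measurable_funD.
rewrite (EFinM (2 * l1norm x)) lee_wpmul2l//.
under eq_integral do rewrite !EFinD -!sumEFin.
rewrite ge0_integralD//; last 3 first.
- by rewrite lee_fin sqrtr_ge0.
- by move=> w _; rewrite !sumEFin -EFinD lee_fin addr_ge0 ?sumr_ge0.
- by under eq_fun do rewrite !sumEFin; apply: emeasurable_funD; exact/measurable_EFinP.
rewrite ge0_integralD//; last 4 first.
- by move=> w _; rewrite sumEFin lee_fin sumr_ge0.
- by under eq_fun do rewrite !sumEFin; exact/measurable_EFinP.
- by move=> w _; rewrite sumEFin lee_fin sumr_ge0.
- by under eq_fun do rewrite !sumEFin; exact/measurable_EFinP.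
rewrite integral_cst_probability.
rewrite ge0_integral_sum//; last 2 first.
- by move=> s; exact/measurable_EFinP.
- by move=> s w _; rewrite lee_fin.
rewrite ge0_integral_sum//; last 2 first.
- by move=> s; exact/measurable_EFinP.
- by move=> s w _; rewrite lee_fin.
rewrite !EFinD leeD2l// leeD//.
- apply: (@le_trans _ _ (\sum_(s : k.-tuple ('I_n * bool))
      (expR (- (l * m%:R / 4)))%:E)%E); first by apply: lee_sum => s _.
  by rewrite sumEFin lee_fin sumr_const card_tuple card_prod card_ord card_bool
    mulr_natl.
- apply: (@le_trans _ _ (\sum_(i < n) (expR (- m%:R))%:E)%E).
    by apply: lee_sum => i _.
  by rewrite sumEFin lee_fin sumr_const card_ord mulr_natl.
Qed.

End random_matrix.

(** * Choice of the constant and assembly of the bound *)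

Theorem theorem4p6p4 (R : realType) :
  forall L : R, 0 < L ->
  exists2 C : R, 0 < C &
    forall (n m s : nat), (2 <= n)%N -> (1 <= m)%N ->
    forall (d : measure_display) (T : measurableType d) (P : probability T R)
      (A : T -> 'M[R]_(m, n)),
      (forall i : 'I_m, random_vector (random_row A i)) ->
      independent_vectors P (random_row A) ->
      (forall i : 'I_m, isotropic P (random_row A i)) ->
      (forall i : 'I_m, subgaussian_vector P (random_row A i)) ->
      (forall i : 'I_m, (psi2_norm_vector P (random_row A i) <= L%:E)%E) ->
    forall x : 'cV[R]_n, sparse s x ->
    forall xhat : T -> 'cV[R]_n,
      random_vector xhat ->
      {ae P, forall w, l1_min_solution (A w) (A w *m x) (xhat w)} ->
      ('E_P[fun w => l2norm (xhat w - x)] <=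
        (C * Num.sqrt (s%:R * ln n%:R / m%:R) * l2norm x)%:E)%E.
Proof.
(* Any fixed multiple of [L] strictly above it would do for [t]. *)
move=> L L0; pose t := 2 * L.
have t0 : 0 < t by exact: mulr_gt0.
have Lt : L < t by rewrite /t; lra.
pose l : R := (6 * t ^+ 4)^-1.
have l0 : 0 < l by rewrite invr_gt0 mulr_gt0// exprn_gt0.
(* The bound [l / 16] pays for the union over signed sums, the bound 1 for the one over columns. *)
pose c := Num.min (l / 16) 1.
have c0 : 0 < c by rewrite lt_min ltr01 andbT divr_gt0.
have cl : c <= l / 16 by rewrite ge_min lexx.
have c1 : c <= 1 by rewrite ge_min lexx orbT.
pose B := Num.sqrt (32 * t ^+ 2) + 3.
have B3 : 3 <= B by rewrite lerDr sqrtr_ge0.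
exists (2 * B * Num.sqrt c^-1).
  by rewrite !mulr_gt0 ?sqrtr_gt0 ?invr_gt0//; lra.
move=> n m s n2 m1 d T P A mA indA isoA _ psiA x sx xhat mxhat xhatP.
have m0 : 0 < m%:R :> R by rewrite ltr0n.
pose q : R := ln n%:R / (c * m%:R).
have [q0 x0] := (sqrtr_ge0 q, l1norm_ge0 x).
(* Sparsity enters only here, turning [|x|_1] into [sqrt s |x|_2]; the factor [c] in [q] moves into
   the constant. *)
suff H : ('E_P[fun w => l2norm (xhat w - x)] <=
    (2 * l1norm x * (B * Num.sqrt q))%:E)%E.
  apply: (le_trans H); rewrite lee_fin.
  have -> : Num.sqrt (s%:R * ln n%:R / m%:R) =
      Num.sqrt s%:R * Num.sqrt (ln n%:R / m%:R :> R).
    by rewrite -mulrA sqrtrM.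
  have -> : Num.sqrt q = Num.sqrt c^-1 * Num.sqrt (ln n%:R / m%:R).
    rewrite -sqrtrM ?invr_ge0 ?(ltW c0)//; congr Num.sqrt.
    by rewrite /q invfM mulrCA.
  set r := Num.sqrt (_ / _); set v := Num.sqrt c^-1.
  rewrite [leRHS](_ : _ = 2 * B * v * r * (Num.sqrt s%:R * l2norm x)); last by ring.
  rewrite [leLHS](_ : _ = 2 * B * v * r * l1norm x); last by ring.
  rewrite ler_wpM2l ?l1norm_sparse// !mulr_ge0 ?sqrtr_ge0//; lra.
have [q1|[k k1 kq]] := sparsity_tradeoff t l0 c0 cl c1 n2 m1.
- apply: (le_trans (expected_error_le_l1norm mxhat xhatP)).
  rewrite lee_fin -[leLHS]mulr1 ler_wpM2l ?mulr_ge0//.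
  by apply: (le_trans q1); rewrite ler_wpM2r//; lra.
- apply: (le_trans (expected_error_le mA indA isoA psiA mxhat xhatP m1 k1 Lt t0
    (erefl l))).
  by rewrite lee_fin ler_wpM2l ?mulr_ge0.
Qed.
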